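(* Let $(\mathcal A,\sigma)$ be an involutive ring and let $M=\begin{bmatrix}A&B\\ C&D\end{bmatrix}$ and $N=\begin{bmatrix}E&F\\ G&H\end{bmatrix}$ be elements of $\mathrm{Sp}_2(\mathcal A,\sigma)$ with invertible entries. The seed $S_{MN}$ is mutation equivalent to the seed given by amalgamating $S_M$ and $S_N$ along an identity edge. That is: glue the edge $3$–$4$ of $S_M$ (labeled $1$) to the edge of $S_N$ playing the role of $1$–$2$ (labeled $1$), giving a hexagon with marked points $1,2,3,6,5,4$ in cyclic order, triangulated by the arcs $13,34,46$, with $X_{12}=X_{34}=X_{56}=1$, $X_{13}=A$, $X_{14}=B$, $X_{23}=C$, $X_{46}=E$, $X_{45}=F$, $X_{36}=G$. Then by a finite sequence of mutations one reaches a seed whose triangulation contains the square with vertices $1,2,6,5$ together with its diagonal $16$, and whose restriction to this square is $S_{MN}$ (with $1,2,6,5$ playing the roles of $1,2,3,4$).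
   Context: An involutive ring $(\mathcal A,\sigma)$ is a unital ring with an anti-involution $\sigma$. $\mathrm{Sp}_2(\mathcal A,\sigma)$ is the group of $M=\begin{bmatrix}A&B\\ C&D\end{bmatrix}\in\mathrm{Mat}_2(\mathcal A)$ satisfying $\sigma(A)C=\sigma(C)A$, $\sigma(B)D=\sigma(D)B$, $\sigma(A)D-\sigma(C)B=1$, $A\sigma(B)=B\sigma(A)$, $C\sigma(D)=D\sigma(C)$, $A\sigma(D)-B\sigma(C)=1$. A noncommutative seed (with values in $\mathcal A$) on a polygon is a triangulation with an element $X_{ij}\in\mathcal A$ for each oriented arc or side $i\to j$, with $X_{ji}=\sigma(X_{ij})$, such that for each triangle $ijk$ the noncommutative angle $T_i^{jk}=X_{ji}^{-1}X_{jk}X_{ik}^{-1}$ satisfies $T_i^{jk}=T_i^{kj}$. Mutation at a diagonal $ik$, contained in the quadrilateral with vertices $i,j,k,l$ in cyclic order, replaces $ik$ by the other diagonal $jl$ with $X_{jl}=X_{jk}X_{ik}^{-1}X_{il}+X_{ji}X_{ki}^{-1}X_{kl}$. For $M\in\mathrm{Sp}_2(\mathcal A,\sigma)$ the seed $S_M$ on a square with vertices $1,2,3,4$ in cyclic order uses the triangulation with diagonal $13$ and $X_{13}=A$, $X_{23}=C$, $X_{14}=B$, $X_{12}=X_{34}=1$.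
   Formalization: The entries of MN labeling the square need not be invertible when those of M and N are (e.g. AE+BG=0), and then S_MN is not a seed; the labelings reached are asserted to be seeds only when these labels of S_MN are invertible, while the mutations and labels are asserted always. *)

(* Defs.v *)
From mathcomp Require Import all_boot all_order all_algebra.
Set Implicit Arguments.
Unset Strict Implicit.
Unset Printing Implicit Defensive.
Import GRing.Theory.
Local Open Scope ring_scope.

Definition anti_involution (A : unitRingType) (sigma : A -> A) : Prop :=
  [/\ forall x y, sigma (x + y) = sigma x + sigma y,
      sigma 1 = 1,
      forall x y, sigma (x * y) = sigma y * sigma x
    & involutive sigma].

Definition Sp2 (A : unitRingType) (sigma : A -> A) (M : 'M[A]_2) : Prop :=
  let a := M 0 0 in let b := M 0 1 in let c := M 1 0 in let d := M 1 1 in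
  [/\ sigma a * c = sigma c * a,
      sigma b * d = sigma d * b &
      sigma a * d - sigma c * b = 1] /\
  [/\ a * sigma b = b * sigma a,
      c * sigma d = d * sigma c &
      a * sigma d - b * sigma c = 1].

Definition invertible_entries (A : unitRingType) (M : 'M[A]_2) : Prop :=
  forall i j, M i j \is a GRing.unit.

(* The n-gon has vertex set 'I_n, and 0, 1, ..., n - 1 is its cyclic order. *)
Definition cyclic_order (n : nat) (i j k l : 'I_n) : bool :=
  [|| [&& (i < j)%N, (j < k)%N & (k < l)%N],
      [&& (j < k)%N, (k < l)%N & (l < i)%N],
      [&& (k < l)%N, (l < i)%N & (i < j)%N]
    | [&& (l < i)%N, (i < j)%N & (j < k)%N]].

(* A triangulation is given by its oriented arcs and sides, each in both       *)
(* orientations: a maximal set of pairwise non-crossing segments.  Sides cross *)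
(* nothing, so maximality puts them in T.                                      *)
Definition triangulation (n : nat) (T : {set 'I_n * 'I_n}) : Prop :=
  [/\ forall i j, (i, j) \in T -> i != j /\ (j, i) \in T,
      forall i j k l, (i, k) \in T -> (j, l) \in T -> ~~ cyclic_order i j k l
    & forall i k, i != k ->
        (forall j l, (j, l) \in T -> ~~ cyclic_order i j k l) ->
        (i, k) \in T].

(* lab i j is X_ij; it is meaningful only for (i, j) \in arcs. *)
Record labelling (A : unitRingType) (n : nat) := Labelling {
  arcs : {set 'I_n * 'I_n};
  lab : 'I_n -> 'I_n -> A }.

Definition same_labelling (A : unitRingType) (n : nat)
    (S S' : labelling A n) : Prop :=
  arcs S = arcs S' /\
  (forall i j, (i, j) \in arcs S -> lab S i j = lab S' i j).

Definition invertible_labels (A : unitRingType) (n : nat)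
    (S : labelling A n) : Prop :=
  forall i j, (i, j) \in arcs S -> lab S i j \is a GRing.unit.

(* T_i^{jk} *)
Definition angle (A : unitRingType) (n : nat) (S : labelling A n)
    (i j k : 'I_n) : A :=
  (lab S j i)^-1 * lab S j k * (lab S i k)^-1.

(* Every label of a triangulation occurs inverted in some angle, so labels are *)
(* required to be units.  Three vertices of a polygon that are pairwise joined *)
(* by arcs or sides always bound a triangle of the triangulation.              *)
Definition seed (A : unitRingType) (sigma : A -> A) (n : nat)
    (S : labelling A n) : Prop :=
  [/\ triangulation (arcs S),
      invertible_labels S,
      forall i j, (i, j) \in arcs S -> lab S j i = sigma (lab S i j)
    & forall i j k, (i, j) \in arcs S -> (j, k) \in arcs S ->
        (i, k) \in arcs S -> angle S i j k = angle S i k j].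

Definition mutable (A : unitRingType) (n : nat) (S : labelling A n)
    (i j k l : 'I_n) : Prop :=
  [/\ cyclic_order i j k l,
      (i, k) \in arcs S,
      [/\ (i, j) \in arcs S, (j, k) \in arcs S,
          (k, l) \in arcs S & (l, i) \in arcs S]
    & lab S i k \is a GRing.unit /\ lab S k i \is a GRing.unit].

Definition mutate (A : unitRingType) (sigma : A -> A) (n : nat)
    (S : labelling A n) (i j k l : 'I_n) : labelling A n :=
  let Xjl := lab S j k * (lab S i k)^-1 * lab S i l
             + lab S j i * (lab S k i)^-1 * lab S k l in
  {| arcs := (j, l) |: ((l, j) |: (arcs S :\ (i, k) :\ (k, i)));
     lab := fun p q => if (p, q) == (j, l) then Xjl
                       else if (p, q) == (l, j) then sigma Xjl
                       else lab S p q |}.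

Definition mutation (A : unitRingType) (sigma : A -> A) (n : nat)
    (S S' : labelling A n) : Prop :=
  exists i j k l, mutable S i j k l /\ S' = mutate sigma S i j k l.

(* The restriction of S to the m-gon whose vertices are f 0, ..., f (m - 1). *)
Definition restriction (A : unitRingType) (m n : nat) (f : 'I_m -> 'I_n)
    (S : labelling A n) : labelling A m :=
  {| arcs := [set e | (f e.1, f e.2) \in arcs S];
     lab := fun i j => lab S (f i) (f j) |}.

(* An entry ((i, j), x) of the table sets X_ij = x and X_ji = sigma x. *)
Definition lookup (A : unitRingType) (n : nat)
    (t : seq (('I_n * 'I_n) * A)) (e : 'I_n * 'I_n) : option A :=
  ohead [seq y.2 | y <- t & y.1 == e].

Definition of_table (A : unitRingType) (sigma : A -> A) (n : nat)
    (t : seq (('I_n * 'I_n) * A)) : labelling A n :=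
  {| arcs := [set e | (e \in unzip1 t) || ((e.2, e.1) \in unzip1 t)];
     lab := fun i j =>
       if lookup t (i, j) is Some x then x
       else if lookup t (j, i) is Some x then sigma x else 0 |}.

Definition s1 : 'I_4 := @Ordinal 4 0 isT.
Definition s2 : 'I_4 := @Ordinal 4 1 isT.
Definition s3 : 'I_4 := @Ordinal 4 2 isT.
Definition s4 : 'I_4 := @Ordinal 4 3 isT.

(* S_M *)
Definition square_seed (A : unitRingType) (sigma : A -> A) (M : 'M[A]_2) :
    labelling A 4 :=
  of_table sigma
    [:: ((s1, s3), M 0 0); ((s2, s3), M 1 0); ((s1, s4), M 0 1);
        ((s1, s2), 1); ((s3, s4), 1)].

(* The marked points are named 1, 2, 3, 6, 5, 4 in cyclic order. *)
Definition h1 : 'I_6 := @Ordinal 6 0 isT.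
Definition h2 : 'I_6 := @Ordinal 6 1 isT.
Definition h3 : 'I_6 := @Ordinal 6 2 isT.
Definition h6 : 'I_6 := @Ordinal 6 3 isT.
Definition h5 : 'I_6 := @Ordinal 6 4 isT.
Definition h4 : 'I_6 := @Ordinal 6 5 isT.

Definition amalgam (A : unitRingType) (sigma : A -> A) (M N : 'M[A]_2) :
    labelling A 6 :=
  of_table sigma
    [:: ((h1, h2), 1); ((h3, h4), 1); ((h5, h6), 1);
        ((h1, h3), M 0 0); ((h1, h4), M 0 1); ((h2, h3), M 1 0);
        ((h4, h6), N 0 0); ((h4, h5), N 0 1); ((h3, h6), N 1 0)].

(* The square in the hexagon in which a, b, c, d play the roles of 1, 2, 3, 4. *)
Definition subsquare (a b c d : 'I_6) : 'I_4 -> 'I_6 := tnth [tuple a; b; c; d].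

(* Main.v *)
Require Import Defs.
From mathcomp Require Import all_boot all_order all_algebra zify.
Set Implicit Arguments.
Unset Strict Implicit.
Unset Printing Implicit Defensive.
Import GRing.Theory.
Local Open Scope ring_scope.

(** The hexagon 1, 2, 3, 6, 5, 4 is taken from the triangulation 13, 34, 46 to
    the triangulation 16, 26, 15 by flipping 34, then 13, then 46.  Reading off
    the three new labels in terms of M = (A B; C D) and N = (E F; G H),

    - X_16 = A E + B G, because X_34 = 1 ([L16] in the last proof);
    - X_26 = C A^-1 X_16 + sigma(A)^-1 G ([L26]);
    - X_15 = X_16 E^-1 F + B sigma(E)^-1 ([L15]).

    The symplectic relations give D = sigma(A)^-1 + C A^-1 B, and likewise
    H = sigma(E)^-1 + G E^-1 F (lemma [Sp2_unit]), so that the last two labels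
    are C E + D G and A F + B H: together with X_16 they are the entries of
    M N that label the square 1, 2, 6, 5.  Only labels of the first seed get
    inverted along the way, hence the flips make sense even when M N has
    entries that are not units.

    That all four labellings are seeds, once these three entries of M N are
    units, comes from two sources.  The first labelling is one since, in each
    of its four triangles, one side is labelled 1, which turns the symmetry of
    an angle into one of the relations sigma(A) C = sigma(C) A and
    A sigma(B) = B sigma(A), or their analogues for N ([amalgam_seed]).  The
    others are obtained from a general fact, [mutate_seed]: in any polygon, a
    mutation with invertible new label turns seeds into seeds.  Its algebraic core is the additivity of angles,
    T_i^{jl} = T_i^{jk} + T_i^{kl}, which is equivalent to the exchange relation
    that defines X_jl.  Its combinatorial core is that flipping a diagonal of a
    triangulation gives a triangulation ([mutate_triangulation]). *)

(** * Flips of triangulations *)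

Lemma cyclic_order_rot n (i j k l : 'I_n) :
  cyclic_order i j k l = cyclic_order j k l i.
Proof. by rewrite /cyclic_order; apply/idP/idP; lia. Qed.

Lemma cyclic_order_neq n (i j k l : 'I_n) : cyclic_order i j k l ->
  [/\ i != j, i != k, i != l & [/\ j != k, j != l & k != l]].
Proof. by rewrite -!val_eqE /cyclic_order /= => H; do ?split; lia. Qed.

(** A segment pq that crosses the diagonal jl of a quadrilateral ijkl leaves it
    on each side of jl through a vertex or through one of the two sides there.
    It is thus the other diagonal, or it crosses jk or kl, or it crosses li or
    ij. *)
Lemma diagonal_crossing n (i j k l p q : 'I_n) :
    cyclic_order i j k l -> cyclic_order j p l q ->
  [\/ p = k /\ q = i,
      cyclic_order j p k q \/ cyclic_order k p l q
    | cyclic_order l q i p \/ cyclic_order i q j p].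
Proof.
move=> cijkl cjplq; have [pk|pk] := eqVneq p k; last first.
  by apply: Or32; move: cijkl cjplq pk; rewrite -val_eqE /cyclic_order /=; lia.
have [qi|qi] := eqVneq q i; first exact: Or31.
by apply: Or33; move: cijkl cjplq qi; rewrite pk -val_eqE /cyclic_order /=; lia.
Qed.

(** Any vertex p off the diagonal ik lies on one of its two sides, and so pj or
    pl crosses ik. *)
Lemma diagonal_sides n (i j k l p : 'I_n) :
    cyclic_order i j k l -> p != i -> p != k ->
  cyclic_order i j k p \/ cyclic_order i p k l.
Proof. by rewrite -!val_eqE /cyclic_order /=; lia. Qed.

Lemma mem_mutate (A : unitRingType) (sigma : A -> A) n (S : labelling A n)
    i j k l p q :
  (p, q) \in arcs (mutate sigma S i j k l) =
  [|| (p, q) == (j, l), (p, q) == (l, j)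
    | [&& (p, q) != (k, i), (p, q) != (i, k) & (p, q) \in arcs S]].
Proof. by rewrite !inE. Qed.

(** Both claims rest on [diagonal_crossing].  No arc other than ik crosses jl,
    as it would cross a side of the quadrilateral.  For maximality, a segment
    that crosses no arc of the new triangulation either crosses no arc of the
    old one, or crosses ik but no side, which leaves only jl. *)
Lemma mutate_triangulation (A : unitRingType) (sigma : A -> A) n
    (S : labelling A n) i j k l :
  triangulation (arcs S) -> mutable S i j k l ->
  triangulation (arcs (mutate sigma S i j k l)).
Proof.
move=> [Tsym Tnc Tmax] [c ik [ij jk kl li] _].
have [nij nik nil [njk njl nkl]] := cyclic_order_neq c.
have Tmem p q := mem_mutate sigma S i j k l p q.
have old p q : (p, q) != (i, k) -> (p, q) != (k, i) -> (p, q) \in arcs S ->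
    (p, q) \in arcs (mutate sigma S i j k l).
  by move=> h1 h2 h3; rewrite Tmem h1 h2 h3 !orbT.
have T'sym p q : (p, q) \in arcs (mutate sigma S i j k l) ->
    p != q /\ (q, p) \in arcs (mutate sigma S i j k l).
  rewrite !Tmem !xpair_eqE => /or3P[/andP[/eqP-> /eqP->]|/andP[/eqP-> /eqP->]|].
  - by rewrite !eqxx orbT.
  - by rewrite !eqxx eq_sym.
  case/and3P=> h1 h2 /Tsym[-> ->]; split=> //; rewrite andbT.
  by rewrite (andbC (q == k)) (andbC (q == i)) h1 h2 !orbT.
have jl_nc p q : (p, q) \in arcs S -> (p, q) != (k, i) ->
    ~~ cyclic_order j p l q.
  move=> pq npq; apply/negP => /(diagonal_crossing c)[[pk qi]|[]|[]].
  - by rewrite pk qi eqxx in npq.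
  - by apply/negP; apply: Tnc.
  - by apply/negP; apply: Tnc.
  - by apply/negP; apply: Tnc; rewrite ?(proj2 (Tsym _ _ pq)).
  - by apply/negP; apply: Tnc; rewrite ?(proj2 (Tsym _ _ pq)).
split=> //.
- move=> p q r s.
  rewrite !Tmem => /or3P[/eqP[-> ->]|/eqP[-> ->]|/and3P[h1 h2 pr]].
  + case/or3P=> [/eqP[-> ->]|/eqP[-> ->]|/and3P[h3 h4 qs]].
    * by apply/negP=> /cyclic_order_neq[]; rewrite eqxx.
    * by apply/negP=> /cyclic_order_neq[_ _]; rewrite eqxx.
    * exact: jl_nc.
  + case/or3P=> [/eqP[-> ->]|/eqP[-> ->]|/and3P[h3 h4 qs]].
    * by apply/negP=> /cyclic_order_neq[_ _]; rewrite eqxx.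
    * by apply/negP=> /cyclic_order_neq[]; rewrite eqxx.
    * rewrite 2!cyclic_order_rot; apply: jl_nc (proj2 (Tsym _ _ qs)) _.
      by move: h4; rewrite !xpair_eqE andbC.
  + case/or3P=> [/eqP[-> ->]|/eqP[-> ->]|/and3P[h3 h4 qs]].
    * rewrite cyclic_order_rot; apply: jl_nc (proj2 (Tsym _ _ pr)) _.
      by move: h2; rewrite !xpair_eqE andbC.
    * by rewrite 3!cyclic_order_rot; apply: jl_nc.
    * exact: Tnc.
- move=> p q npq nc.
  have [e1|n1] := eqVneq (p, q) (j, l); first by rewrite Tmem e1 eqxx.
  have [e1|n2] := eqVneq (p, q) (l, j); first by rewrite Tmem e1 eqxx orbT.
  have jl : (j, l) \in arcs (mutate sigma S i j k l) by rewrite Tmem eqxx.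
  have [_ lj] := T'sym _ _ jl.
  apply: (old p q).
  + by apply/eqP=> -[pi qk]; move: (nc _ _ jl); rewrite pi qk c.
  + by apply/eqP=> -[pi qk]; move: (nc _ _ lj); rewrite pi qk 2!cyclic_order_rot c.
  have sides : [/\ (i, j) \in arcs (mutate sigma S i j k l),
      (j, k) \in arcs (mutate sigma S i j k l),
      (k, l) \in arcs (mutate sigma S i j k l)
    & (l, i) \in arcs (mutate sigma S i j k l)].
    split; apply: old => //; rewrite xpair_eqE negb_and;
      by rewrite ?(eq_sym j i) ?(eq_sym k i) ?(eq_sym k j) ?(eq_sym l i)
                 ?(eq_sym l k) ?nij ?nik ?nil ?njk ?nkl ?orbT.
  (* Here [diagonal_crossing] is applied to the quadrilateral lijk, whose
     diagonal in the role of jl is ik. *)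
  have ik_nc a b : (a, b) != (j, l) -> (forall r s,
      (r, s) \in arcs (mutate sigma S i j k l) -> ~~ cyclic_order a r b s) ->
      ~~ cyclic_order i a k b.
    case: sides => ij' jk' kl' li' nab ncab; apply/negP.
    have c' : cyclic_order l i j k by rewrite cyclic_order_rot.
    case/(diagonal_crossing c')=> [[aj bl]|[]|[]].
    - by rewrite aj bl eqxx in nab.
    - have [_ ji'] := T'sym _ _ ij'.
      by rewrite cyclic_order_rot (negbTE (ncab _ _ ji')).
    - have [_ kj'] := T'sym _ _ jk'.
      by rewrite cyclic_order_rot (negbTE (ncab _ _ kj')).
    - by rewrite 3!cyclic_order_rot (negbTE (ncab _ _ kl')).
    - by rewrite 3!cyclic_order_rot (negbTE (ncab _ _ li')).
  apply: Tmax => // r s rs.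
  have [e|n3] := eqVneq (r, s) (i, k); last first.
    have [e|n4] := eqVneq (r, s) (k, i); last exact: nc (old _ _ n3 n4 rs).
    case: e => -> ->; rewrite 3!cyclic_order_rot; exact: ik_nc.
  case: e => -> ->; rewrite cyclic_order_rot; apply: ik_nc.
    by move: n2; rewrite !xpair_eqE andbC.
  by move=> a b /T'sym[_ ba]; rewrite 2!cyclic_order_rot; apply: nc.
Qed.

(** * Mutations of seeds *)

Lemma mutate_lab_new (A : unitRingType) (sigma : A -> A) n (S : labelling A n)
    i j k l :
  lab (mutate sigma S i j k l) j l =
    lab S j k * (lab S i k)^-1 * lab S i l
    + lab S j i * (lab S k i)^-1 * lab S k l.
Proof. by rewrite /= eqxx. Qed.

Lemma mutate_lab_rev (A : unitRingType) (sigma : A -> A) n (S : labelling A n)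
    i j k l : j != l ->
  lab (mutate sigma S i j k l) l j = sigma (lab (mutate sigma S i j k l) j l).
Proof. by move=> jl; rewrite /= !eqxx xpair_eqE [l == j]eq_sym (negbTE jl). Qed.

Lemma mutate_lab_old (A : unitRingType) (sigma : A -> A) n (S : labelling A n)
    i j k l p q : (p, q) != (j, l) -> (p, q) != (l, j) ->
  lab (mutate sigma S i j k l) p q = lab S p q.
Proof. by move=> h1 h2; rewrite /= (negbTE h1) (negbTE h2). Qed.

Lemma mutate_sym (A : unitRingType) (sigma : A -> A) n (S : labelling A n)
    i j k l :
    anti_involution sigma -> j != l ->
    (forall p q, (p, q) \in arcs S -> lab S q p = sigma (lab S p q)) ->
  forall p q, (p, q) \in arcs (mutate sigma S i j k l) ->
    lab (mutate sigma S i j k l) q p = sigma (lab (mutate sigma S i j k l) p q).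
Proof.
move=> [_ _ _ sK] njl symS p q; rewrite mem_mutate.
have [[-> ->] _|n1] := eqVneq (p, q) (j, l); first by rewrite mutate_lab_rev.
have [[-> ->] _|n2] := eqVneq (p, q) (l, j); first by rewrite mutate_lab_rev ?sK.
case/and3P=> _ _ pq; rewrite (mutate_lab_old _ _ _ _ n1 n2) -symS //.
by apply: mutate_lab_old; [move: n2|move: n1]; rewrite !xpair_eqE andbC.
Qed.

Lemma sigma_unitV (A : unitRingType) (sigma : A -> A) (x : A) :
    anti_involution sigma -> x \is a GRing.unit ->
  sigma x \is a GRing.unit /\ sigma x^-1 = (sigma x)^-1.
Proof.
case=> _ s1 sM _ ux.
have V1 : sigma x^-1 * sigma x = 1 by rewrite -sM divrr.
have V2 : sigma x * sigma x^-1 = 1 by rewrite -sM mulVr.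
have us : sigma x \is a GRing.unit by apply/unitrP; exists (sigma x^-1).
by split=> //; apply: (mulIr us); rewrite V1 mulVr.
Qed.

(** The equation T_i^{jk} = T_i^{kj} amounts to
    X_ij X_kj^-1 X_ki = X_ik X_jk^-1 X_ji, and dividing by X_ij on the left and
    by X_ji on the right turns this into T_j^{ki} = T_j^{ik}. *)
Lemma angle_rot (A : unitRingType) n (S : labelling A n) i j k :
    invertible_labels S ->
    (forall p q, (p, q) \in arcs S -> (q, p) \in arcs S) ->
    (i, j) \in arcs S -> (j, k) \in arcs S -> (i, k) \in arcs S ->
  angle S i j k = angle S i k j -> angle S j k i = angle S j i k.
Proof.
move=> uS sym ij jk ik; have [[ji kj] ki] := (sym _ _ ij, sym _ _ jk, sym _ _ ik).
have [[uij ujk] uik] := (uS _ _ ij, uS _ _ jk, uS _ _ ik).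
have [[uji ukj] uki] := (uS _ _ ji, uS _ _ kj, uS _ _ ki).
move=> /(congr1 GRing.inv); rewrite /angle.
rewrite !(invrM, unitrMl, unitrV) ?invrK //.
move=> /(congr1 (fun x => (lab S i j)^-1 * x * (lab S j i)^-1)).
by rewrite !mulrA mulVr // mul1r mulrK // => ->.
Qed.

Lemma angle_triangle (A : unitRingType) n (S : labelling A n) i j k :
    invertible_labels S ->
    (forall p q, (p, q) \in arcs S -> (q, p) \in arcs S) ->
    (i, j) \in arcs S -> (j, k) \in arcs S -> (i, k) \in arcs S ->
    angle S i j k = angle S i k j ->
  [/\ angle S i j k = angle S i k j, angle S j k i = angle S j i k
    & angle S k i j = angle S k j i].
Proof.
move=> uS sym ij jk ik e; split; [exact: e | exact: (angle_rot uS sym ij jk ik)|].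
exact/esym/(angle_rot uS sym ik (sym _ _ jk) ij)/esym.
Qed.

(** A triangle of the new triangulation that has jl as a side has i or k as its
    third vertex.  At that vertex the new angle is a sum of two old ones, as
    T_i^{jl} = T_i^{jk} + T_i^{kl}, hence it is symmetric; [angle_rot] carries
    the symmetry over to the other two vertices. *)
Lemma mutate_seed (A : unitRingType) (sigma : A -> A) n (S : labelling A n)
    i j k l :
    anti_involution sigma -> seed sigma S -> mutable S i j k l ->
    lab (mutate sigma S i j k l) j l \is a GRing.unit ->
  seed sigma (mutate sigma S i j k l).
Proof.
move=> hs [triS uS symS angS] mutS; set S' := mutate _ _ _ _ _ _ => ujl.
have triS' : triangulation (arcs S') by apply: mutate_triangulation.
have [T'sym _ _] := triS'.
have [Tsym Tnc _] := triS.
have [c ik [ij jk kl li] _] := mutS.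
have [nij nik nil [njk njl nkl]] := cyclic_order_neq c.
have sym p q : (p, q) \in arcs S -> (q, p) \in arcs S by case/Tsym.
have sym' p q : (p, q) \in arcs S' -> (q, p) \in arcs S' by case/T'sym.
have [[[ji kj] lk] il] := (sym _ _ ij, sym _ _ jk, sym _ _ kl, sym _ _ li).
have ki := sym _ _ ik.
have jlS : (j, l) \notin arcs S by apply/negP=> /(Tnc _ _ _ _ ik); rewrite c.
have ljS : (l, j) \notin arcs S by apply: contra jlS; apply: sym.
have lab_old p q : (p, q) \in arcs S -> lab S' p q = lab S p q.
  by move=> pq; apply: mutate_lab_old; apply/eqP=> e; move: pq;
    rewrite e ?(negbTE jlS) ?(negbTE ljS).
have lab_jl := mutate_lab_new sigma S i j k l; rewrite -/S' in lab_jl.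
have lab_lj' : lab S' l j = sigma (lab S' j l) by apply: mutate_lab_rev.
have symS' : forall p q, (p, q) \in arcs S' -> lab S' q p = sigma (lab S' p q).
  exact: mutate_sym.
have [sD _ sM _] := hs.
have sV p q : (p, q) \in arcs S -> sigma (lab S p q)^-1 = (lab S q p)^-1.
  by move=> pq; rewrite (proj2 (sigma_unitV hs (uS _ _ pq))) -symS.
have lab_lj : lab S' l j = lab S l i * (lab S k i)^-1 * lab S k j
     + lab S l k * (lab S i k)^-1 * lab S i j.
  by rewrite lab_lj' lab_jl sD !sM !sV // -!symS // !mulrA.
have memS' p q : (p, q) \in arcs S' ->
    [\/ (p, q) = (j, l), (p, q) = (l, j) | (p, q) \in arcs S].
  rewrite mem_mutate => /or3P[/eqP|/eqP|/and3P[_ _]] h;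
    by [apply: Or31|apply: Or32|apply: Or33].
clearbody S'.
have uS' : invertible_labels S'.
  move=> p q /memS'[[-> ->] //|[-> ->]|pq].
    by rewrite lab_lj'; case: (sigma_unitV hs ujl).
  by rewrite lab_old //; apply: uS.
split=> //.
have apex p : (j, p) \in arcs S' -> (l, p) \in arcs S' -> p = i \/ p = k.
  move=> jp lp; have [pi|ni] := eqVneq p i; first by left.
  have [pk|nk] := eqVneq p k; first by right.
  have jpS : (j, p) \in arcs S.
    case/memS': (jp) => [[pl]|[jl _]|//]; last by rewrite jl eqxx in njl.
    by case/T'sym: lp; rewrite pl eqxx.
  have lpS : (l, p) \in arcs S.
    case/memS': (lp) => [[lj _]|[pj]|//]; first by rewrite lj eqxx in njl.
    by case/T'sym: jp; rewrite pj eqxx.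
  case: (diagonal_sides c ni nk); first by rewrite (negbTE (Tnc _ _ _ _ ik jpS)).
  by rewrite (negbTE (Tnc _ _ _ _ ik (sym _ _ lpS))).
have new p : (j, p) \in arcs S' -> (l, p) \in arcs S' ->
    angle S' p j l = angle S' p l j.
  move=> jp lp; case: (apex p jp lp) => ->.
    have -> : angle S' i j l = angle S i j k + angle S i k l.
      rewrite /angle lab_jl !lab_old // mulrDr mulrDl !mulrA mulVr ?uS // mul1r.
      by rewrite mulrK ?uS.
    have -> : angle S' i l j = angle S i l k + angle S i k j.
      rewrite /angle lab_lj !lab_old // mulrDr mulrDl !mulrA mulVr ?uS // mul1r.
      by rewrite mulrK ?uS // addrC.
    by rewrite addrC angS // [angle S i j k]angS.
  have -> : angle S' k j l = angle S k j i + angle S k i l.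
    rewrite /angle lab_jl !lab_old // mulrDr mulrDl !mulrA mulVr ?uS // mul1r.
    by rewrite mulrK ?uS // addrC.
  have -> : angle S' k l j = angle S k l i + angle S k i j.
    rewrite /angle lab_lj !lab_old // mulrDr mulrDl !mulrA mulVr ?uS // mul1r.
    by rewrite mulrK ?uS.
  by rewrite addrC angS // [angle S k j i]angS.
move=> p q r pq qr pr.
have [[qp rq] rp] := (sym' _ _ pq, sym' _ _ qr, sym' _ _ pr).
case/memS': (qr) => [[qj rl]|[ql rj]|qrS].
- by subst; exact: new.
- by subst; rewrite new.
case/memS': (pr) => [[pj rl]|[pl rj]|prS].
- subst p r; apply/esym/(angle_rot uS' sym' qp pr qr).
  by apply: new => //; apply: sym'.
- subst p r; apply/esym/(angle_rot uS' sym' qp pr qr).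
  by apply/esym/new => //; apply: sym'.
case/memS': (pq) => [[pj ql]|[pl qj]|pqS].
- subst p q; apply: (angle_rot uS' sym' rp pq rq).
  by apply: new.
- subst p q; apply: (angle_rot uS' sym' rp pq rq).
  by apply/esym/new.
have [qpS rpS] := (sym _ _ pqS, sym _ _ prS).
by rewrite /angle !lab_old ?(sym _ _ qrS) //; apply: angS.
Qed.

(** * Labellings given by tables *)

Lemma mem_of_table (A : unitRingType) (sigma : A -> A) n
    (t : seq (('I_n * 'I_n) * A)) i j :
  ((i, j) \in arcs (of_table sigma t)) =
  ((i, j) \in unzip1 t) || ((j, i) \in unzip1 t).
Proof. by rewrite inE. Qed.

Lemma lookupP (A : unitRingType) n (t : seq (('I_n * 'I_n) * A)) e :
  if lookup t e is Some x then (e, x) \in t else e \notin unzip1 t.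
Proof.
elim: t => // -[e' x] t; rewrite /lookup /=.
have [->|ne] := eqVneq e' e => /=; first by rewrite inE eqxx.
case: ohead => [y|]; first by rewrite inE orbC => ->.
by rewrite inE negb_or eq_sym ne.
Qed.

Lemma of_table_invertible (A : unitRingType) (sigma : A -> A) n
    (t : seq (('I_n * 'I_n) * A)) :
    anti_involution sigma -> {in unzip2 t, forall x, x \is a GRing.unit} ->
  invertible_labels (of_table sigma t).
Proof.
move=> hs ut i j; rewrite mem_of_table /=.
have in2 e x : (e, x) \in t -> x \is a GRing.unit.
  by move=> ex; apply/ut/mapP; exists (e, x).
case: lookup (lookupP t (i, j)) => [x /in2 //|/negbTE->] /=.
case: lookup (lookupP t (j, i)) => [x /in2 ux _|/negbTE-> //].
by case: (sigma_unitV hs ux).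
Qed.

Lemma of_table_sym (A : unitRingType) (sigma : A -> A) n
    (t : seq (('I_n * 'I_n) * A)) :
    anti_involution sigma ->
    {in unzip1 t, forall e, (e.2, e.1) \notin unzip1 t} ->
  forall i j, (i, j) \in arcs (of_table sigma t) ->
    lab (of_table sigma t) j i = sigma (lab (of_table sigma t) i j).
Proof.
move=> [_ _ _ sK] ht i j; rewrite mem_of_table /=.
have in1 e x : (e, x) \in t -> e \in unzip1 t.
  by move=> ex; apply/mapP; exists (e, x).
case: lookup (lookupP t (i, j)) => [x /in1 /ht /= ji _|/negbTE->] /=;
  case: lookup (lookupP t (j, i)) => [y /in1 h|h].
- by rewrite h in ji.
- by [].
- by rewrite sK.
- by rewrite (negbTE h).
Qed.

Lemma hexagon_ind (P : 'I_6 -> Prop) :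
  P h1 -> P h2 -> P h3 -> P h6 -> P h5 -> P h4 -> forall i, P i.
Proof.
move=> P1 P2 P3 P6 P5 P4 [[|[|[|[|[|[|//]]]]]] lt_i6].
- by congr P: P1; apply: val_inj.
- by congr P: P2; apply: val_inj.
- by congr P: P3; apply: val_inj.
- by congr P: P6; apply: val_inj.
- by congr P: P5; apply: val_inj.
- by congr P: P4; apply: val_inj.
Qed.

Lemma square_ind (P : 'I_4 -> Prop) :
  P s1 -> P s2 -> P s3 -> P s4 -> forall i, P i.
Proof.
move=> P1 P2 P3 P4 [[|[|[|[|//]]]] lt_i4].
- by congr P: P1; apply: val_inj.
- by congr P: P2; apply: val_inj.
- by congr P: P3; apply: val_inj.
- by congr P: P4; apply: val_inj.
Qed.

(** * The amalgam of two symplectic matrices *)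

(** With sigma(a) c = sigma(c) a and a sigma(b) = b sigma(a), the first two
    relations say that T_1^{23} and T_1^{34} are symmetric in the square seed of
    M.  The last one, which is sigma(a) d - sigma(c) b = 1, recovers d from the
    three entries that the square seed records. *)
Lemma Sp2_unit (A : unitRingType) (sigma : A -> A) (M : 'M[A]_2) :
    anti_involution sigma -> Sp2 sigma M -> invertible_entries M ->
  [/\ M 1 0 * (M 0 0)^-1 = (sigma (M 0 0))^-1 * sigma (M 1 0),
      (sigma (M 0 0))^-1 * (M 0 1)^-1 = (sigma (M 0 1))^-1 * (M 0 0)^-1
    & M 1 1 = (sigma (M 0 0))^-1 + M 1 0 * (M 0 0)^-1 * M 0 1].
Proof.
move=> hs [[h1 _ h3] [h4 _ _]] uM.
have ua := uM 0 0; have ub := uM 0 1.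
have [usa _] := sigma_unitV hs ua; have [usb _] := sigma_unitV hs ub.
have ca : M 1 0 * (M 0 0)^-1 = (sigma (M 0 0))^-1 * sigma (M 1 0).
  by apply: (mulrI usa); rewrite mulrA h1 mulrK // mulVKr.
split=> //; first by rewrite -!invrM // h4.
by apply: (mulrI usa); rewrite ca mulrDr !mulrA mulrV // mul1r -h3 subrK.
Qed.

(** The list behind [amalgam], named so that membership in its arcs becomes a
    computation on keys. *)
Definition amalgam_table (A : unitRingType) (M N : 'M[A]_2) :=
  [:: ((h1, h2), 1); ((h3, h4), 1); ((h5, h6), 1);
      ((h1, h3), M 0 0); ((h1, h4), M 0 1); ((h2, h3), M 1 0);
      ((h4, h6), N 0 0); ((h4, h5), N 0 1); ((h3, h6), N 1 0)].

Lemma mem_amalgam (A : unitRingType) (sigma : A -> A) (M N : 'M[A]_2) i j :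
  ((i, j) \in arcs (amalgam sigma M N)) =
  ((i, j) \in unzip1 (amalgam_table M N))
  || ((j, i) \in unzip1 (amalgam_table M N)).
Proof. exact: mem_of_table. Qed.

Lemma amalgam_triangulation (A : unitRingType) (sigma : A -> A) (M N : 'M[A]_2) :
  triangulation (arcs (amalgam sigma M N)).
Proof.
have mem := mem_amalgam sigma M N.
split.
- by elim/hexagon_ind; elim/hexagon_ind; rewrite !mem.
- move=> i j k l; rewrite !mem; move: i k.
  elim/hexagon_ind; elim/hexagon_ind => //= _; move: j l;
    by elim/hexagon_ind; elim/hexagon_ind.
- move=> i k nik nc.
  have crossed j l :
      ((j, l) \in arcs (amalgam sigma M N)) && cyclic_order i j k l = false.
    by apply/negP => /andP[/nc/negP].
  (* Each segment outside the triangulation crosses one of its diagonals. *)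
  move: (crossed h1 h3) (crossed h3 h1) (crossed h3 h4) (crossed h4 h3)
    (crossed h4 h6) (crossed h6 h4).
  by rewrite !mem; move: i k nik {nc crossed}; elim/hexagon_ind;
    elim/hexagon_ind.
Qed.

(** The symmetry is checked at vertex 1 in the triangles 123 and 134, and at
    vertex 4, which plays the role of 1 for N, in 436 and 465; there both
    angles are products of two units. *)
Lemma amalgam_seed (A : unitRingType) (sigma : A -> A) (M N : 'M[A]_2) :
    anti_involution sigma -> Sp2 sigma M -> Sp2 sigma N ->
    invertible_entries M -> invertible_entries N ->
  seed sigma (amalgam sigma M N).
Proof.
move=> hs hM hN uM uN; have [_ s1 _ _] := hs.
have tri := amalgam_triangulation sigma M N.
have uS : invertible_labels (amalgam sigma M N).
  apply: of_table_invertible => // x; rewrite !inE.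
  by do ![case/orP=> [/eqP->|]] => [||||||||/eqP->]; rewrite ?unitr1 ?uM ?uN.
split=> //.
  apply: of_table_sym => // e; rewrite !inE.
  by do ![case/orP=> [/eqP->|]] => [||||||||/eqP->].
have sym p q : (p, q) \in arcs (amalgam sigma M N) ->
    (q, p) \in arcs (amalgam sigma M N) by case: tri => T _ _ /T[].
have [M1 M2 _] := Sp2_unit hs hM uM; have [N1 N2 _] := Sp2_unit hs hN uN.
have a123 : angle (amalgam sigma M N) h1 h2 h3 = angle (amalgam sigma M N) h1 h3 h2.
  by rewrite /angle /= s1 invr1 mul1r mulr1.
have a134 : angle (amalgam sigma M N) h1 h3 h4 = angle (amalgam sigma M N) h1 h4 h3.
  by rewrite /angle /= s1 !mulr1.
have a436 : angle (amalgam sigma M N) h4 h3 h6 = angle (amalgam sigma M N) h4 h6 h3.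
  by rewrite /angle /= s1 invr1 mul1r mulr1.
have a465 : angle (amalgam sigma M N) h4 h6 h5 = angle (amalgam sigma M N) h4 h5 h6.
  by rewrite /angle /= s1 !mulr1.
have mem := mem_amalgam sigma M N.
(* An abstract S keeps the case analysis on triangles from unfolding labels. *)
move: (amalgam sigma M N) uS sym mem a123 a134 a436 a465 => S uS sym mem.
have spread := angle_triangle uS sym.
move=> /spread[]; rewrite ?mem // => e1 e2 e3.
move=> /spread[]; rewrite ?mem // => e4 e5 e6.
move=> /spread[]; rewrite ?mem // => e7 e8 e9.
move=> /spread[]; rewrite ?mem // => e10 e11 e12.
clear -mem e1 e2 e3 e4 e5 e6 e7 e8 e9 e10 e11 e12.
elim/hexagon_ind; elim/hexagon_ind => k; rewrite mem // => _;
  by move: k; elim/hexagon_ind; rewrite !mem.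
Qed.

Definition square_table (A : unitRingType) (M : 'M[A]_2) :=
  [:: ((s1, s3), M 0 0); ((s2, s3), M 1 0); ((s1, s4), M 0 1);
      ((s1, s2), 1); ((s3, s4), 1)].

Lemma mem_square_seed (A : unitRingType) (sigma : A -> A) (M : 'M[A]_2) i j :
  ((i, j) \in arcs (square_seed sigma M)) =
  ((i, j) \in unzip1 (square_table M)) || ((j, i) \in unzip1 (square_table M)).
Proof. exact: mem_of_table. Qed.

(** Compatibility with sigma reduces the comparison to one orientation of each
    arc. *)
Lemma same_square_seed (A : unitRingType) (sigma : A -> A) (M : 'M[A]_2)
    (S : labelling A 4) :
    (forall i j, ((i, j) \in arcs S) = ((i, j) \in arcs (square_seed sigma M))) ->
    (forall i j, (i, j) \in arcs S -> lab S j i = sigma (lab S i j)) ->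
    lab S s1 s3 = M 0 0 -> lab S s2 s3 = M 1 0 -> lab S s1 s4 = M 0 1 ->
    lab S s1 s2 = 1 -> lab S s3 s4 = 1 ->
  same_labelling S (square_seed sigma M).
Proof.
move=> eT symS e13 e23 e14 e12 e34; split; first by apply/setP => -[].
move=> i j ij.
have sym i' j' x : (i', j') \in arcs S -> lab S i' j' = x ->
    lab S j' i' = sigma x by move=> /symS-> ->.
have mem := mem_square_seed sigma M.
have e31 := sym _ _ _ _ e13; have e32 := sym _ _ _ _ e23.
have e41 := sym _ _ _ _ e14; have e21 := sym _ _ _ _ e12.
have e43 := sym _ _ _ _ e34.
move: i j ij; elim/square_ind; elim/square_ind; rewrite eT mem //= => _;
  by rewrite ?e13 ?e23 ?e14 ?e12 ?e34 ?e31 ?e32 ?e41 ?e21 ?e43 ?eT ?mem.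
Qed.

Theorem proposition7p27 (A : unitRingType) (sigma : A -> A) (M N : 'M[A]_2)
  (hsigma : anti_involution sigma)
  (hM : Sp2 sigma M) (hN : Sp2 sigma N)
  (uM : invertible_entries M) (uN : invertible_entries N) :
  [/\ seed sigma (amalgam sigma M N),
      same_labelling (restriction (subsquare h1 h2 h3 h4) (amalgam sigma M N))
        (square_seed sigma M),
      same_labelling (restriction (subsquare h4 h3 h6 h5) (amalgam sigma M N))
        (square_seed sigma N)
    & exists (m : nat) (S : nat -> labelling A 6),
        [/\ S 0%N = amalgam sigma M N,
            forall t : nat, (t < m)%N -> mutation sigma (S t) (S t.+1),
            same_labelling (restriction (subsquare h1 h2 h6 h5) (S m))
              (square_seed sigma (M *m N))
          & invertible_labels (square_seed sigma (M *m N)) ->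
            forall t : nat, (t <= m)%N -> seed sigma (S t)]].
Proof.
have [_ sigma1 _ _] := hsigma.
have S0seed := amalgam_seed hsigma hM hN uM uN.
set S0 := amalgam sigma M N in S0seed *.
have [S0tri S0unit S0sym _] := S0seed.
have mem0 := mem_amalgam sigma M N; rewrite -/S0 in mem0.
have memQ P := mem_square_seed sigma P.
have memR f (S : labelling A 6) i j :
    ((i, j) \in arcs (@restriction A 4 6 f S)) = ((f i, f j) \in arcs S).
  by rewrite inE.
split; first exact: S0seed.
- apply: same_square_seed; [|by move=> i j; rewrite memR => /S0sym|by []..].
  by elim/square_ind; elim/square_ind; rewrite memR mem0 memQ.
- apply: same_square_seed; [|by move=> i j; rewrite memR => /S0sym|by []..].
  by elim/square_ind; elim/square_ind; rewrite memR mem0 memQ.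
have [_ _ dM] := Sp2_unit hsigma hM uM; have [_ _ dN] := Sp2_unit hsigma hN uN.
have entry i j : (M *m N) i j = M i 0 * N 0 j + M i 1 * N 1 j.
  by rewrite mxE !big_ord_recl big_ord0 addr0; congr (_ + M i _ * N _ j);
    apply: val_inj.
set S1 := mutate sigma S0 h4 h1 h3 h6.
set S2 := mutate sigma S1 h1 h2 h3 h6.
set S3 := mutate sigma S2 h4 h1 h6 h5.
have keep1 p q : (p, q) != (h1, h6) -> (p, q) != (h6, h1) ->
  lab S1 p q = lab S0 p q by apply: mutate_lab_old.
have keep2 p q : (p, q) != (h2, h6) -> (p, q) != (h6, h2) ->
  lab S2 p q = lab S1 p q by apply: mutate_lab_old.
have keep3 p q : (p, q) != (h1, h5) -> (p, q) != (h5, h1) ->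
  lab S3 p q = lab S2 p q by apply: mutate_lab_old.
have L16 : lab S1 h1 h6 = (M *m N) 0 0.
  by rewrite mutate_lab_new /= sigma1 invr1 !mulr1 entry.
have L26 : lab S2 h2 h6 = (M *m N) 1 0.
  rewrite mutate_lab_new L16 !keep1 //= sigma1 mul1r !entry dM.
  by rewrite mulrDr !mulrA mulrVK ?uM // mulrDl addrA addrAC.
have L15 : lab S3 h1 h5 = (M *m N) 0 1.
  rewrite mutate_lab_new !keep2 // L16 !keep1 //= sigma1 mulr1 !entry dN.
  by rewrite !mulrDl mulrK ?uN // mulrDr !mulrA addrAC -addrA.
have mut1 : mutable S0 h4 h1 h3 h6.
  split=> //; rewrite ?mem_of_table //.
  by split; apply: S0unit; rewrite mem_of_table.
have mut2 : mutable S1 h1 h2 h3 h6.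
  split=> //; rewrite ?mem_mutate ?mem_of_table //.
  by rewrite !keep1 //; split; apply: S0unit; rewrite mem_of_table.
have mut3 : mutable S2 h4 h1 h6 h5.
  split=> //; rewrite ?mem_mutate ?mem_of_table //.
  by rewrite !keep2 // !keep1 //; split; apply: S0unit; rewrite mem_of_table.
exists 3%N, (nth S0 [:: S0; S1; S2; S3]); split=> //.
- case=> [|[|[|//]]] _ /=; [exists h4, h1, h3, h6|exists h1, h2, h3, h6
    |exists h4, h1, h6, h5]; by split.
- apply: same_square_seed.
  + by elim/square_ind; elim/square_ind; rewrite memR !mem_mutate mem0 memQ.
  + move=> i j; rewrite memR; apply: mutate_sym => //; apply: mutate_sym => //.
    exact: mutate_sym.
  + by change (lab S3 h1 h6 = (M *m N) 0 0); rewrite keep3 // keep2.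
  + by change (lab S3 h2 h6 = (M *m N) 1 0); rewrite keep3.
  + exact: L15.
  + by change (lab S3 h1 h2 = 1); rewrite keep3 // keep2 // keep1.
  + by change (lab S3 h6 h5 = 1); rewrite keep3 // keep2 // keep1 //= sigma1.
move=> uMN; have u16 := uMN s1 s3; have u26 := uMN s2 s3; have u15 := uMN s1 s4.
rewrite !memQ in u16 u26 u15.
have S1seed : seed sigma S1.
  by apply: mutate_seed => //; rewrite -/S1 L16; apply: u16.
have S2seed : seed sigma S2.
  by apply: mutate_seed => //; rewrite -/S2 L26; apply: u26.
have S3seed : seed sigma S3.
  by apply: mutate_seed => //; rewrite -/S3 L15; apply: u15.
by case=> [|[|[|[|t]]]] ht; [exact: S0seed|exact: S1seed|exact: S2seed
  |exact: S3seed|].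
Qed.
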